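(* Let $\lambda$ be a frequency. Then $\sigma_{\mathcal H_1(\lambda)}\le 2\sigma_{\mathcal H_2(\lambda)}$.
   Context: A frequency is a (strictly) increasing sequence $\lambda=(\lambda_n)_{n\ge1}$ of nonnegative real numbers tending to $+\infty$. A $\lambda$-Dirichlet series is a formal series $D=\sum_{n\ge1} a_n e^{-\lambda_n s}$, $a_n\in\mathbb C$. For $\theta\in\mathbb R$, $\mathbb C_\theta=\{s\in\mathbb C:\mathrm{Re}\,s>\theta\}$. Hardy spaces: let $G$ be a compact abelian group (with normalized Haar measure) and $\beta:(\mathbb R,+)\to G$ a continuous homomorphism with dense range. $(G,\beta)$ is a $\lambda$-Dirichlet group if for every $n$ there is $h_{\lambda_n}\in\widehat G$ with $h_{\lambda_n}(\beta(t))=e^{-i\lambda_n t}$ for all $t\in\mathbb R$; such a group always exists. For $p\in[1,+\infty]$, $H_p^\lambda(G)$ is the subspace of $f\in L_p(G)$ with $\widehat f$ supported in $\{h_{\lambda_n}:n\in\mathbb N\}$. $\mathcal H_p(\lambda)$ is the space of all $\lambda$-Dirichlet series $\sum_n\widehat f(h_{\lambda_n})e^{-\lambda_ns}$, $f\in H_p^\lambda(G)$, with norm $\|\sum_n\widehat f(h_{\lambda_n})e^{-\lambda_ns}\|_p=\|f\|_p$; it does not depend on the chosen $\lambda$-Dirichlet group. For $p<\infty$ it is equivalently the completion of the $\lambda$-Dirichlet polynomials $D=\sum_{n=1}^Na_ne^{-\lambda_ns}$ under $\|D\|_p^p=\lim_{T\to+\infty}\frac1{2T}\int_{-T}^T|D(it)|^p\,dt$.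 For a $\lambda$-Dirichlet series $D$, $\sigma_c(D)=\inf\{\sigma\in\mathbb R: D\text{ converges on }\mathbb C_\sigma\}$, and $\sigma_{\mathcal H_p(\lambda)}=\inf\{\sigma\in\mathbb R:\ \sigma_c(D)\le\sigma\text{ for all }D\in\mathcal H_p(\lambda)\}$ (with values in $[-\infty,+\infty]$). *)

(* Defs.v *)
From HB Require Import structures.
From mathcomp Require Import all_boot all_order all_algebra complex.
From mathcomp Require Import all_classical all_reals all_analysis.

Set Implicit Arguments.
Unset Strict Implicit.
Unset Printing Implicit Defensive.
Import Order.TTheory GRing.Theory Num.Theory.
Import numFieldNormedType.Exports.
Local Open Scope classical_set_scope.
Local Open Scope ring_scope.
Local Open Scope complex_scope.

(* The n-th term (n >= 1) of a frequency or of a coefficient sequence has index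
   n.-1 here, and a formal lam-Dirichlet series is identified with its sequence
   of coefficients. R[i] receives its topology through R[i]^o. *)

Definition Cexp (R : realType) (z : R[i]) : R[i] :=
  let: x +i* y := z in (expR x)%:C * (cos y +i* sin y).

Definition is_frequency (R : realType) (lam : nat -> R) : Prop :=
  [/\ forall n, 0 <= lam n,
      {homo lam : m n / (m < n)%N >-> m < n} &
      lam n @[n --> \oo] --> +oo].

Section DirichletSeries.
Variables (R : realType) (lam : nat -> R).

Definition half_plane (theta : R) : set R[i] := [set s | theta < complex.Re s].

Definition dirichlet_cvg (a : nat -> R[i]) (s : R[i]) : Prop :=
  cvgn (series (fun n => a n * Cexp (- (lam n)%:C * s)) : nat -> R[i]^o).

Definition sigma_c (a : nat -> R[i]) : \bar R :=
  ereal_inf [set sigma%:E | sigma in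
    [set sigma : R | forall s, half_plane sigma s -> dirichlet_cvg a s]].

End DirichletSeries.

Definition borel (G : topologicalZmodType) : Type := G.

Section BorelInstance.
Variable G : topologicalZmodType.

HB.instance Definition _ := Choice.on (borel G).
HB.instance Definition _ := isPointed.Build (borel G) (0 : G).

Lemma borel_measurableC (A : set (borel G)) :
  <<s @open G >> A -> <<s @open G >> (~` A).
Proof. by move=> sA; rewrite -setTD; exact: sigma_algebraCD. Qed.

HB.instance Definition _ := @isMeasurable.Build (sigma_display (@open G))
  (borel G) <<s @open G >> (@sigma_algebra0 _ setT (@open G))
  borel_measurableC (@sigma_algebra_bigcup _ setT (@open G)).

End BorelInstance.

Section CompactGroup.
Variables (R : realType) (G : topologicalZmodType).
Variable mu : probability (borel G) R.

(* The regularity clause is part of the definition: on a non-metrizable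
   compact group it is what makes the invariant Borel probability unique. *)
Definition is_haar : Prop :=
  (forall (x : G) (A : set (borel G)), measurable A ->
     mu [set x + y | y in (A : set G)] = mu A) /\
  (forall A : set (borel G), measurable A ->
     mu A = ereal_sup [set mu K | K in
              [set K : set G | compact K /\ K `<=` A]]).

Definition is_character (h : G -> R[i]) : Prop :=
  [/\ continuous (h : G -> R[i]^o),
      forall x, ComplexField.Normc.normc (h x) = 1 &
      forall x y, h (x + y) = h x * h y].

Definition in_Lp (p : \bar R) (f : G -> R[i]) : Prop :=
  [/\ measurable_fun setT ((fun x => complex.Re (f x)) : borel G -> R),
      measurable_fun setT ((fun x => complex.Im (f x)) : borel G -> R) &
      (Lnorm mu p (fun x => (ComplexField.Normc.normc (f x))%:E) < +oo)%E].

Definition Cintegral (f : G -> R[i]) : R[i] :=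
  Rintegral mu setT (fun x => complex.Re (f x)) +i*
  Rintegral mu setT (fun x => complex.Im (f x)).

Definition fourier_coef (f h : G -> R[i]) : R[i] :=
  Cintegral (fun x => f x * (h x)^*).

End CompactGroup.

Section HardySpace.
Variables (R : realType) (lam : nat -> R) (G : topologicalZmodType).
Variables (mu : probability (borel G) R) (beta : R -> G).

(* [extends_exp l h]: h is the character h_l. It is unique when beta has dense
   range. *)
Definition extends_exp (l : R) (h : G -> R[i]) : Prop :=
  is_character h /\ forall t, h (beta t) = Cexp (0 -i* (l * t)).

Definition is_dirichlet_group : Prop :=
  [/\ compact [set: G], hausdorff_space G &
      [/\ continuous beta, (forall s t, beta (s + t) = beta s + beta t),
          dense (range beta) &
          forall n, exists h, extends_exp (lam n) h]].

Definition in_HpG (p : \bar R) (f : G -> R[i]) : Prop :=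
  in_Lp mu p f /\
  forall h, is_character h -> (forall n, ~ extends_exp (lam n) h) ->
    fourier_coef mu f h = 0.

Definition Hardy (p : \bar R) : set (nat -> R[i]) :=
  [set a | exists2 f, in_HpG p f &
     forall n h, extends_exp (lam n) h -> a n = fourier_coef mu f h].

Definition sigma_H (p : \bar R) : \bar R :=
  ereal_inf [set sigma%:E | sigma in
    [set sigma : R | forall a, Hardy p a -> (sigma_c lam a <= sigma%:E)%E]].

End HardySpace.

(* Main.v *)
(* Orthonormality of the characters h_{lambda_n} and completeness of L_2(G)
   make every square summable sequence the coefficient sequence of an element
   of H_2. If all these series converge at tau, then by Abel-Dini
   sum_n exp(- 2 lambda_n tau) is finite. Coefficients of an element of H_1 are
   bounded by a multiple of its norm, so its series converges absolutely on
   Re s > 2 tau. *)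
Require Import Defs.
From mathcomp Require Import all_boot all_order all_algebra complex ring lra.
From mathcomp Require Import all_classical all_reals all_analysis.
From mathcomp Require Import measurable_realfun.

Set Implicit Arguments.
Unset Strict Implicit.
Unset Printing Implicit Defensive.
Import Order.TTheory GRing.Theory Num.Theory.
Import numFieldNormedType.Exports.
Import ComplexField.Normc.
Local Open Scope classical_set_scope.
Local Open Scope ring_scope.
Local Open Scope complex_scope.

(** * Limits and series of complex numbers *)

(** The argument is a duality in l2. For [b n = expR (- lam n * tau)], if the sum of [a n * b n]
    converges for every real square summable [a], then [b] is square summable. Otherwise there is an
    explicit bad [a], so no uniform boundedness argument is involved. As [b n ^+ 2] is the modulus
    of the n-th exponential on the line of abscissa [2 * tau], the 2 of the statement is the
    exponent of [L_2]. Only the real point [tau] is tested, where the terms for the bad [a] are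
    positive reals. The analytic weight lies in [H_2]: a function on [G] must be built with
    prescribed coefficients at the characters of the frequency and with vanishing coefficient at
    every other character. *)

Section ComplexLimits.
Variable R : realType.
Implicit Types z w : R[i].

Lemma ler_Re_normc z : `|complex.Re z| <= normc z.
Proof. by have := normc_ge_Re z; rewrite lecE /= => /andP[]. Qed.

Lemma ler_Im_normc z : `|complex.Im z| <= normc z.
Proof.
case: z => x y /=; rewrite -(sqrtr_sqr y) ler_sqrt ?addr_ge0 ?sqr_ge0//.
by rewrite lerDr sqr_ge0.
Qed.

Lemma normc_le_ReIm z : normc z <= `|complex.Re z| + `|complex.Im z|.
Proof.
case: z => x y /=; rewrite -(ger0_norm (addr_ge0 (normr_ge0 x) (normr_ge0 y))).
rewrite -sqrtr_sqr ler_sqrt ?sqr_ge0// sqrrD !real_normK ?num_real//.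
by rewrite [leRHS]addrAC lerDl mulrn_wge0// mulr_ge0.
Qed.

Lemma normc_ge0 z : 0 <= normc z.
Proof. exact: le_trans (ler_Re_normc z). Qed.

Lemma sqr_normcE z : normc z ^+ 2 = complex.Re z ^+ 2 + complex.Im z ^+ 2.
Proof. by case: z => x y /=; rewrite sqr_sqrtr// addr_ge0 ?sqr_ge0. Qed.

Lemma mulcJE z : z * z^* = (normc z ^+ 2)%:C.
Proof.
rewrite sqr_normcE; case: z => x y; apply/eqP.
by rewrite eq_complex /=; apply/andP; split; apply/eqP; ring.
Qed.

Lemma normc_conj z : normc z^* = normc z.
Proof. by case: z => x y /=; rewrite sqrrN. Qed.

Lemma normc_real (x : R) : normc x%:C = `|x|.
Proof. by rewrite /= expr0n addr0 sqrtr_sqr. Qed.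

Lemma Re_sum I (r : seq I) (P : pred I) (F : I -> R[i]) :
  complex.Re (\sum_(i <- r | P i) F i) = \sum_(i <- r | P i) complex.Re (F i).
Proof. by apply: (big_morph (@complex.Re R)) => // -[? ?] [? ?]. Qed.

Lemma Im_sum I (r : seq I) (P : pred I) (F : I -> R[i]) :
  complex.Im (\sum_(i <- r | P i) F i) = \sum_(i <- r | P i) complex.Im (F i).
Proof. by apply: (big_morph (@complex.Im R)) => // -[? ?] [? ?]. Qed.

Lemma Re_continuous : continuous (@complex.Re R : R[i]^o -> R).
Proof.
move=> z; apply/(@cvgrPdist_lt _ _ _ (nbhs (z : R[i]^o))) => e e0.
have e0' : (0 : R[i]) < e%:C by rewrite ltcE /= eqxx.
apply: (@filterS _ (nbhs (z : R[i]^o)) _ _ _ _ (nbhsx_ballx (z : R[i]^o) _ e0')) => w.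
rewrite -ball_normE /= ltcE /= => /andP[_]; apply: le_lt_trans.
by case: z w => [a b] [c d]; exact: (ler_Re_normc ((a - c) +i* (b - d))).
Qed.

Lemma Im_continuous : continuous (@complex.Im R : R[i]^o -> R).
Proof.
move=> z; apply/(@cvgrPdist_lt _ _ _ (nbhs (z : R[i]^o))) => e e0.
have e0' : (0 : R[i]) < e%:C by rewrite ltcE /= eqxx.
apply: (@filterS _ (nbhs (z : R[i]^o)) _ _ _ _ (nbhsx_ballx (z : R[i]^o) _ e0')) => w.
rewrite -ball_normE /= ltcE /= => /andP[_]; apply: le_lt_trans.
by case: z w => [a b] [c d]; exact: (ler_Im_normc ((a - c) +i* (b - d))).
Qed.

Lemma cvg_complex T (F : set_system T) {FF : Filter F} (u v : T -> R) (a b : R) :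
  u @ F --> a -> v @ F --> b ->
  (fun t => (u t +i* v t) : R[i]^o) @ F --> ((a +i* b) : R[i]^o).
Proof.
(* In the order of [R[i]], [0 < e] forces a zero imaginary part, so the real part of [e] is the
   actual radius. *)
move=> ua vb; apply/cvgrPdist_lt => e; rewrite ltcE /= => /andP[/eqP Ime e0].
have e20 : 0 < complex.Re e / 2 by rewrite divr_gt0.
near=> t.
have [hu hv] : `|a - u t| < complex.Re e / 2 /\ `|b - v t| < complex.Re e / 2.
  by split; near: t; [apply: cvgr_dist_lt ua _ _|apply: cvgr_dist_lt vb _ _].
rewrite ltcE /= Ime eqxx /=.
apply: (le_lt_trans (normc_le_ReIm ((a - u t) +i* (b - v t)))) => /=.
by rewrite (splitr (complex.Re e)) ltrD.
Unshelve. all: by end_near. Qed.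

Lemma is_cvg_series_Re (z : nat -> R[i]) :
  cvgn (series z : nat -> R[i]^o) ->
  cvgn (series (fun n => complex.Re (z n))).
Proof.
move=> /cvg_ex[l zl]; apply/cvg_ex; exists (complex.Re l).
have := cvg_comp _ _ zl (@Re_continuous l).
by apply: cvg_trans; apply: near_eq_cvg; near=> n; rewrite /series /= Re_sum.
Unshelve. all: by end_near. Qed.

Lemma normc_cvg_series_ReIm (z : nat -> R[i]) :
  cvgn (series (fun n => normc (z n))) ->
  cvgn (series (fun n => complex.Re (z n))) /\
  cvgn (series (fun n => complex.Im (z n))).
Proof.
move=> zc; split; apply: normed_cvg; apply: series_le_cvg zc => n //=;
  by rewrite ?normc_ge0 ?ler_Re_normc ?ler_Im_normc.
Qed.

Lemma normc_cvg_series (z : nat -> R[i]) :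
  cvgn (series (fun n => normc (z n))) -> cvgn (series z : nat -> R[i]^o).
Proof.
move=> /normc_cvg_series_ReIm[cRe cIm].
suff <- : (fun n => series (fun n => complex.Re (z n)) n +i*
    series (fun n => complex.Im (z n)) n) = series z.
  exact: (cvgP _ (cvg_complex cRe cIm)).
apply/funext => n; rewrite /series /= -Re_sum -Im_sum.
by case: (\sum_(0 <= _ < _) _).
Qed.

End ComplexLimits.

(** * Square summable multipliers *)

Section AbelDini.
Variable R : realType.

(** Telescoping: since [b n ^+ 2 = S n.+1 - S n], the term at [n >= 1] is at most
    [(S n)^-1 - (S n.+1)^-1]. The denominator is [S n.+1], which contains [b n] and is therefore
    positive already at [n = 0]. *)
Lemma sqr_summable_ratio (b : nat -> R) : (forall n, 0 < b n) ->
  cvgn (series (fun n => (b n / series (fun k => b k ^+ 2) n.+1) ^+ 2)).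
Proof.
move=> b0; set S := series (fun k => b k ^+ 2).
have S1 : S 1%N = b 0%N ^+ 2 by rewrite /S /series /= big_nat1.
have Sr n : S n.+1 = S n + b n ^+ 2 by rewrite /S seriesSr.
have S0 n : 0 < S n.+1.
  elim: n => [|n IH]; first by rewrite S1 exprn_gt0.
  by rewrite Sr addr_gt0// exprn_gt0.
(* The term at 0 is [(S 1)^-1 = (b 0 ^+ 2)^-1], and the telescoping sum adds at most
   [(S 1)^-1 - (S n.+1)^-1]; hence the 2. *)
have bnd n : series (fun n => (b n / S n.+1) ^+ 2) n.+1 <=
    2 / b 0%N ^+ 2 - (S n.+1)^-1.
  elim: n => [|n IH].
    rewrite /series /= big_nat1 S1.
    suff -> : (b 0%N / b 0%N ^+ 2) ^+ 2 = 2 / b 0%N ^+ 2 - (b 0%N ^+ 2)^-1 by rewrite lexx.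
    by field; rewrite lt0r_neq0.
  rewrite seriesSr; apply: le_trans (lerD IH (lexx _)) _.
  rewrite -addrA lerD2l -lerBrDl expr_div_n.
  rewrite [S n.+2]Sr; move: (S0 n) (b0 n.+1).
  move: (S n.+1) (b n.+1) => s t s0 t0.
  have st0 : 0 < s + t ^+ 2 by rewrite addr_gt0// exprn_gt0.
  suff -> : - (s + t ^+ 2)^-1 - - s^-1 = t ^+ 2 / (s * (s + t ^+ 2)).
    rewrite ler_wpM2l ?sqr_ge0// lef_pV2 ?posrE ?exprn_gt0 ?mulr_gt0//.
    by rewrite expr2 ler_pM2r// lerDl sqr_ge0.
  by field; rewrite !lt0r_neq0.
apply: nondecreasing_is_cvgn.
  by apply: nondecreasing_series => n _ _; exact: sqr_ge0.
exists (2 / b 0%N ^+ 2) => _ [n _ <-].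
apply: (@le_trans _ _ (series (fun n => (b n / S n.+1) ^+ 2) n.+1)).
  by rewrite seriesSr lerDl sqr_ge0.
by apply: le_trans (bnd n) _; rewrite gerBl invr_ge0 ltW.
Qed.

(** The terms from [m] to [n] add up to at least [1 - series c m / series c n]. If the ratios were
    summable, this would stay below 1/2 from some [m] on, so [series c n <= 2 * series c m], and
    [series c] would be bounded. *)
Lemma series_ratio_dvg (c : nat -> R) : (forall n, 0 < c n) ->
  ~ cvgn (series c) -> ~ cvgn (series (fun n => c n / series c n.+1)).
Proof.
move=> c0 cdvg ccvg.
have Sge0 n : 0 <= series c n by apply: sumr_ge0 => i _; exact: ltW.
have Snd : nondecreasing_seq (series c).
  by apply: nondecreasing_series => n _ _; exact: ltW.
have S0 n : 0 < series c n.+1.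
  by rewrite seriesSr ltr_wpDl.
set r := series _ in ccvg.
have rnd : nondecreasing_seq r.
  by apply: nondecreasing_series => n _ _; rewrite ltW// divr_gt0.
have rlim n : r n <= limn r by exact: nondecreasing_cvgn_le.
have [m _ /(_ m (leqnn m)) hm] : \forall n \near \oo, `|limn r - r n| < 1 / 2.
  by apply: cvgr_dist_lt => //; rewrite divr_gt0.
have {}hm : limn r - r m < 1 / 2 by rewrite (le_lt_trans (ler_norm _)).
apply: cdvg; apply: nondecreasing_is_cvgn => //.
exists (2 * series c m + series c m.+1) => _ [n _ <-].
have [nm|mn] := leqP n m.
  apply: le_trans (Snd _ _ nm) _.
  by rewrite -lerBlDr mulr_natl mulr2n; have := Sge0 m; have := S0 m; lra.
have Sn0 : 0 < series c n.
  by apply: lt_le_trans (S0 m) _; exact: Snd.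
have : (series c n - series c m) / series c n <= r n - r m.
  rewrite /r !sub_series ltnW// mulr_suml big_nat [leRHS]big_nat ler_sum// => i.
  move=> /andP[_ iltn]; rewrite ler_pM2l// lef_pV2 ?posrE//.
  exact: Snd.
have := rlim n; have := S0 m.
rewrite ler_pdivrMr// => h1 h2 h3.
have : (r n - r m) * series c n <= 1 / 2 * series c n.
  by rewrite ler_pM2r//; lra.
lra.
Qed.

(* Abel-Dini: divide by the partial sums of the divergent series. *)
Lemma exists_sqr_summable_dvg (b : nat -> R) : (forall n, 0 < b n) ->
  ~ cvgn (series (fun n => b n ^+ 2)) ->
  exists2 a : nat -> R, cvgn (series (fun n => a n ^+ 2)) &
    ~ cvgn (series (fun n => a n * b n)).
Proof.
move=> b0 bdvg.
exists (fun n => b n / series (fun k => b k ^+ 2) n.+1).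
  exact: sqr_summable_ratio.
suff -> : (fun n => b n / series (fun k => b k ^+ 2) n.+1 * b n) =
    (fun n => b n ^+ 2 / series (fun k => b k ^+ 2) n.+1).
  by apply: series_ratio_dvg => // n; rewrite exprn_gt0.
by apply/funext => n; rewrite mulrAC -expr2.
Qed.

End AbelDini.

(** * Complex integrals and characters *)

Section ComplexIntegral.
Variables (R : realType) (G : topologicalZmodType).
Variable mu : probability (borel G) R.
Implicit Types (f g h : G -> R[i]).

Definition Cmeasurable f : Prop :=
  measurable_fun setT ((fun x => complex.Re (f x)) : borel G -> R) /\
  measurable_fun setT ((fun x => complex.Im (f x)) : borel G -> R).

Definition Cintegrable f : Prop :=
  mu.-integrable setT (fun x : borel G => (complex.Re (f x))%:E) /\
  mu.-integrable setT (fun x : borel G => (complex.Im (f x))%:E).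

Lemma continuous_borel_measurable (u : G -> R) :
  continuous u -> measurable_fun setT (u : borel G -> R).
Proof.
move=> /continuousP cu.
apply: (measurability _ (RGenOInfty.measurableE R)) => _ [_ [x ->] <-].
rewrite setTI; apply: sub_sigma_algebra; apply: cu.
exact: interval_open.
Qed.

Lemma measurable_normc f : Cmeasurable f ->
  measurable_fun setT (fun x : borel G => normc (f x)).
Proof.
move=> [mRe mIm].
have -> : (fun x : borel G => normc (f x)) =
    (fun x => Num.sqrt (complex.Re (f x) ^+ 2 + complex.Im (f x) ^+ 2)).
  by apply/funext => x; case: (f x).
apply: (@measurableT_comp _ _ _ _ _ _ (@Num.sqrt R)).
  exact: (continuous_measurable_fun (@sqrt_continuous R)).
by apply: measurable_funD; exact: measurable_funX.
Qed.

Lemma CmeasurableD f g : Cmeasurable f -> Cmeasurable g ->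
  Cmeasurable (fun x => f x + g x).
Proof.
move=> [fRe fIm] [gRe gIm]; split.
- rewrite [X in measurable_fun _ X](_ : _ =
    (fun x => complex.Re (f x) + complex.Re (g x))); last first.
    by apply/funext => x; case: (f x) (g x) => [? ?] [? ?].
  exact: measurable_funD.
- rewrite [X in measurable_fun _ X](_ : _ =
    (fun x => complex.Im (f x) + complex.Im (g x))); last first.
    by apply/funext => x; case: (f x) (g x) => [? ?] [? ?].
  exact: measurable_funD.
Qed.

Lemma CmeasurableM f g : Cmeasurable f -> Cmeasurable g ->
  Cmeasurable (fun x => f x * g x).
Proof.
move=> [fRe fIm] [gRe gIm]; split.
- rewrite [X in measurable_fun _ X](_ : _ = (fun x =>
    complex.Re (f x) * complex.Re (g x) - complex.Im (f x) * complex.Im (g x)));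
    last by apply/funext => x; case: (f x) (g x) => [? ?] [? ?].
  by apply: measurable_funB; exact: measurable_funM.
- rewrite [X in measurable_fun _ X](_ : _ = (fun x =>
    complex.Re (f x) * complex.Im (g x) + complex.Im (f x) * complex.Re (g x)));
    last by apply/funext => x; case: (f x) (g x) => [? ?] [? ?].
  by apply: measurable_funD; exact: measurable_funM.
Qed.

Lemma Cmeasurable_conj f : Cmeasurable f -> Cmeasurable (fun x => (f x)^*).
Proof.
move=> [fRe fIm]; split.
- rewrite [X in measurable_fun _ X](_ : _ = (fun x => complex.Re (f x)))//.
  by apply/funext => x; case: (f x).
- rewrite [X in measurable_fun _ X](_ : _ = (fun x => - complex.Im (f x))).
    exact: measurable_funN.
  by apply/funext => x; case: (f x).
Qed.

Lemma Cmeasurable_cst (c : R[i]) : Cmeasurable (fun=> c).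
Proof. by split; exact: measurable_cst. Qed.

Lemma Cmeasurable_sum I (r : seq I) (F : I -> G -> R[i]) :
  (forall i, Cmeasurable (F i)) -> Cmeasurable (fun x => \sum_(i <- r) F i x).
Proof.
move=> mF; elim: r => [|i r IH].
  by under eq_fun do rewrite big_nil; exact: Cmeasurable_cst.
by under eq_fun do rewrite big_cons; exact: CmeasurableD.
Qed.

Lemma Cintegrable_le f (g : borel G -> \bar R) : Cmeasurable f ->
  mu.-integrable setT g -> (forall x, ((normc (f x))%:E <= g x)%E) ->
  Cintegrable f.
Proof.
move=> [mRe mIm] ig fg.
have g0 x : (`|g x| = g x)%E.
  by rewrite gee0_abs// (le_trans _ (fg x))// lee_fin normc_ge0.
split; (apply: (le_integrable measurableT _ _ ig) => [|x _];
    first exact/measurable_EFinP); rewrite g0; apply: le_trans (fg x);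
  rewrite abse_EFin lee_fin; [exact: ler_Re_normc|exact: ler_Im_normc].
Qed.

Lemma Cintegrable_bounded f (M : R) : Cmeasurable f ->
  (forall x, normc (f x) <= M) -> Cintegrable f.
Proof.
move=> mf fM; apply: (@Cintegrable_le _ (cst M%:E)) => //.
exact: (finite_measure_integrable_cst mu M).
Qed.

Lemma CintegrableD f g : Cintegrable f -> Cintegrable g ->
  Cintegrable (fun x => f x + g x).
Proof.
move=> [fRe fIm] [gRe gIm]; split.
- rewrite (_ : (fun _ => _) =
    (fun x : borel G => (complex.Re (f x))%:E) \+
    (fun x => (complex.Re (g x))%:E))%E; last first.
    by apply/funext => x /=; case: (f x) (g x) => [? ?] [? ?].
  exact: integrableD.
- rewrite (_ : (fun _ => _) =
    (fun x : borel G => (complex.Im (f x))%:E) \+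
    (fun x => (complex.Im (g x))%:E))%E; last first.
    by apply/funext => x /=; case: (f x) (g x) => [? ?] [? ?].
  exact: integrableD.
Qed.

Lemma CintegralD f g : Cintegrable f -> Cintegrable g ->
  Cintegral mu (fun x => f x + g x) = Cintegral mu f + Cintegral mu g.
Proof.
move=> [fRe fIm] [gRe gIm]; apply/eqP; rewrite eq_complex /=.
rewrite -!RintegralD//; apply/andP; split; apply/eqP;
  by apply: eq_Rintegral => x _; case: (f x) (g x) => [? ?] [? ?].
Qed.

Lemma CintegrableZ (c : R[i]) f :
  Cintegrable f -> Cintegrable (fun x => c * f x).
Proof.
move=> [fRe fIm]; split.
- rewrite (_ : (fun _ => _) =
    (fun x : borel G => (complex.Re c)%:E * (complex.Re (f x))%:E) \+
    (fun x => (- complex.Im c)%:E * (complex.Im (f x))%:E))%E; last first.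
    apply/funext => x /=; case: c (f x) => [? ?] [? ?] /=.
    by rewrite -!EFinM -EFinD mulNr.
  by apply: integrableD => //; exact: integrableZl.
- rewrite (_ : (fun _ => _) =
    (fun x : borel G => (complex.Re c)%:E * (complex.Im (f x))%:E) \+
    (fun x => (complex.Im c)%:E * (complex.Re (f x))%:E))%E; last first.
    by apply/funext => x /=; case: c (f x) => [? ?] [? ?] /=.
  by apply: integrableD => //; exact: integrableZl.
Qed.

Lemma CintegralZ (c : R[i]) f : Cintegrable f ->
  Cintegral mu (fun x => c * f x) = c * Cintegral mu f.
Proof.
move=> [fRe fIm]; case: c => a b; apply/eqP; rewrite eq_complex /=.
have iZ (r : R) (u : borel G -> R) :
    mu.-integrable setT (EFin \o u) ->
    mu.-integrable setT (EFin \o (fun x => r * u x)).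
  by move=> iu; exact: (integrableZl measurableT r iu).
rewrite -!RintegralZl// -RintegralB//; try exact: iZ.
rewrite -RintegralD//; try exact: iZ.
by apply/andP; split; apply/eqP; apply: eq_Rintegral => x _; case: (f x).
Qed.

Lemma Cintegral0 : Cintegral mu (fun=> 0) = 0.
Proof. by rewrite /Cintegral /= !Rintegral_cst// !mul0r. Qed.

Lemma Cintegrable0 : Cintegrable (fun=> 0).
Proof. by split; exact: integrable0. Qed.

Lemma Cintegrable_sum I (r : seq I) (F : I -> G -> R[i]) :
  (forall i, Cintegrable (F i)) -> Cintegrable (fun x => \sum_(i <- r) F i x).
Proof.
move=> iF; elim: r => [|i r IH].
  by under eq_fun do rewrite big_nil; exact: Cintegrable0.
by under eq_fun do rewrite big_cons; exact: CintegrableD.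
Qed.

Lemma Cintegral_sum I (r : seq I) (F : I -> G -> R[i]) :
  (forall i, Cintegrable (F i)) ->
  Cintegral mu (fun x => \sum_(i <- r) F i x) =
  \sum_(i <- r) Cintegral mu (F i).
Proof.
move=> iF; elim: r => [|i r IH].
  by under eq_fun do rewrite big_nil; rewrite big_nil Cintegral0.
under eq_fun do rewrite big_cons.
by rewrite CintegralD ?IH ?big_cons//; exact: Cintegrable_sum.
Qed.

End ComplexIntegral.

(** * Orthogonality of characters for Haar measure *)

Section Characters.
Variables (R : realType) (G : topologicalZmodType).
Variable mu : probability (borel G) R.
Implicit Types (f g h : G -> R[i]).

Lemma is_character_measurable h : is_character h -> Cmeasurable h.
Proof.
move=> [ch _ _]; split; apply: continuous_borel_measurable => x.
- exact: (continuous_comp (ch x) (@Re_continuous R (h x))).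
- exact: (continuous_comp (ch x) (@Im_continuous R (h x))).
Qed.

(** This makes [fourier_coef mu h h'] the integral of a single character. It also reduces the
    comparison of two characters to the comparison of one with 1. *)
Lemma is_character_mul_conj h h' : is_character h -> is_character h' ->
  is_character (fun x => h x * (h' x)^*).
Proof.
move=> [ch nh mh] [ch' nh' mh'].
have E : (fun y => h y * (h' y)^*) = (fun y =>
    (complex.Re (h y) * complex.Re (h' y) + complex.Im (h y) * complex.Im (h' y)) +i*
    (complex.Im (h y) * complex.Re (h' y) - complex.Re (h y) * complex.Im (h' y))).
  apply/funext => y; apply/eqP; rewrite eq_complex.
  by case: (h y) (h' y) => a b [c d] /=; apply/andP; split; apply/eqP; ring.
have cRe (k : G -> R[i]) : continuous (k : G -> R[i]^o) ->
    continuous (fun y => complex.Re (k y)).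
  by move=> ck y; exact: (continuous_comp (ck y) (@Re_continuous R (k y))).
have cIm (k : G -> R[i]) : continuous (k : G -> R[i]^o) ->
    continuous (fun y => complex.Im (k y)).
  by move=> ck y; exact: (continuous_comp (ck y) (@Im_continuous R (k y))).
split=> [|x|x y].
- rewrite E => x; apply: cvg_complex.
  + by apply: cvgD; apply: cvgM; (exact: cRe || exact: cIm).
  + by apply: cvgB; apply: cvgM; (exact: cRe || exact: cIm).
- by rewrite normcM normc_conj nh nh' mulr1.
- by rewrite mh mh' rmorphM mulrACA.
Qed.

Lemma Cintegrable_character h : is_character h -> Cintegrable mu h.
Proof.
move=> hc; apply: (@Cintegrable_bounded _ _ _ _ 1).
  exact: is_character_measurable.
by case: hc => _ nh _ x; rewrite nh.
Qed.

Hypothesis haar : is_haar mu.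

Lemma translation_measurable (a : G) :
  measurable_fun setT ((fun x => a + x) : borel G -> borel G).
Proof.
apply: (measurability _ (erefl : @measurable _ (borel G) = <<s @open G >>)).
move=> _ [U oU <-]; rewrite setTI; apply: sub_sigma_algebra.
move: oU; apply: open_comp => x _.
apply: (@continuous2_cvg _ G G G (nbhs x) _ (cst a) id +%R a x).
- exact: (@add_continuous G (a, x)).
- exact: cvg_cst.
- exact: cvg_id.
Qed.

Lemma Rintegral_translation (a : G) (u : borel G -> R) :
  mu.-integrable setT (EFin \o u) ->
  mu.-integrable setT (EFin \o (fun x => u (a + x))) ->
  Rintegral mu setT (fun x => u (a + x)) = Rintegral mu setT u.
Proof.
move=> iu iua; rewrite /Rintegral; congr fine.
have /= <- := @integral_pushforward _ _ (borel G) (borel G) R _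
  (translation_measurable a) mu setT (EFin \o u) (measurable_int _ iu) iua
  measurableT.
apply: eq_measure_integral => [|mphi A mA _].
  exact: translation_measurable.
(* Invariance is stated for images: the preimage of [A] under translation by [a] is its image under
   translation by [- a]. *)
rewrite -[RHS](haar.1 (- a) A mA) /= /pushforward; congr (mu _).
apply/seteqP; split => [x /= Aax|_ [y Ay <-] /=]; last by rewrite addNKr.
by exists (a + x) => //; rewrite addKr.
Qed.

(** Translation by [a] multiplies the integral by [h a] and, by invariance, leaves it unchanged; as
    [h a != 1], it vanishes. *)
Lemma Cintegral_character_eq0 h : is_character h ->
  (exists x, h x != 1) -> Cintegral mu h = 0.
Proof.
move=> hc [a ha1].
have ih := Cintegrable_character hc.
have iha : Cintegrable mu (fun x => h (a + x)).
  have -> : (fun x => h (a + x)) = (fun x => h a * h x).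
    by case: hc => _ _ mh; apply/funext => x; rewrite mh.
  exact: CintegrableZ.
have : Cintegral mu (fun x => h (a + x)) = Cintegral mu h.
  rewrite /Cintegral; congr (_ +i* _).
  - exact: (@Rintegral_translation a (fun x => complex.Re (h x)) ih.1 iha.1).
  - exact: (@Rintegral_translation a (fun x => complex.Im (h x)) ih.2 iha.2).
have -> : (fun x => h (a + x)) = (fun x => h a * h x).
  by case: hc => _ _ mh; apply/funext => x; rewrite mh.
rewrite CintegralZ// => /eqP; rewrite -subr_eq0 -{2}[Cintegral mu h]mul1r -mulrBl.
by rewrite mulf_eq0 subr_eq0 (negbTE ha1) => /eqP.
Qed.

Lemma Cintegral1 : Cintegral mu (fun=> 1) = 1.
Proof.
rewrite /Cintegral /= !Rintegral_cst// mul0r mul1r.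
by rewrite [X in fine X](_ : _ = 1%E)//; exact: probability_setT.
Qed.

Lemma mulc_conj_character h : is_character h -> forall x, h x * (h x)^* = 1.
Proof. by move=> [_ nh _] x; rewrite mulcJE nh expr1n. Qed.

Lemma fourier_coef_character h h' : is_character h -> is_character h' ->
  fourier_coef mu h h' = (h == h')%:R.
Proof.
move=> hc hc'; rewrite /fourier_coef; have [<-|hh'] := eqVneq.
  rewrite -[RHS]Cintegral1; congr (Cintegral mu _).
  by apply/funext => x; rewrite mulc_conj_character.
apply: Cintegral_character_eq0; first exact: is_character_mul_conj.
apply: contrapT => /forallNP h1; move/eqP: hh'; apply.
apply/funext => x; have /negP/negPn/eqP hx := h1 x.
by rewrite -[LHS]mulr1 -(mulc_conj_character hc' x) mulrCA hx mulr1.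
Qed.

End Characters.

(** * The Riesz-Fischer theorem *)

Section Blocks.
Variable R : realType.

(** Cauchy-Schwarz against the weights [2 ^- k.+1], whose total is at most 1, so that the bound does
    not depend on [K]. The induction peels off the first term with [(x + T)^2 <= 2 x^2 + 2 T^2]. *)
Lemma sqr_sum_le (x : nat -> R) (K : nat) :
  (\sum_(k < K) x k) ^+ 2 <= \sum_(k < K) 2 ^+ k.+1 * x k ^+ 2.
Proof.
elim: K x => [|K IH] x; first by rewrite !big_ord0 expr0n.
rewrite !big_ord_recl /=.
set T := \sum_(i < K) _; set U := \sum_(i < K) _.
have TU : 2 * T ^+ 2 <= U.
  rewrite -ler_pdivlMl// mulr_sumr; apply: le_trans (IH (fun k => x k.+1)) _.
  rewrite ler_sum// => i _; rewrite [leRHS]mulrA; apply: ler_wpM2r; first exact: sqr_ge0.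
  by rewrite [in leRHS]exprS mulrA mulVf// mul1r.
rewrite expr1; have := sqr_ge0 (x 0%N - T); rewrite sqrrB sqrrD !mulr_natl; lra.
Qed.

(** The rate [4 ^- k] absorbs the weights [2 ^+ k.+1] of [sqr_sum_le] and still leaves a convergent
    geometric series. [N 0 = 0] lets the blocks start with the first term, and [k <= N k] lets them
    exhaust all the terms. *)
Lemma summable_geometric_blocks (u : nat -> R) :
  (forall n, 0 <= u n) -> cvgn (series u) ->
  exists N : nat -> nat, exists2 C : R,
    [/\ N 0%N = 0%N, forall k, (N k <= N k.+1)%N & forall k, (k <= N k)%N] &
    forall k, \sum_(N k <= n < N k.+1) u n <= C / 4 ^+ k.
Proof.
move=> u0 cu.
have und : nondecreasing_seq (series u) by exact: nondecreasing_series.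
have ulim n : series u n <= limn (series u) by exact: nondecreasing_cvgn_le.
have lim0 : 0 <= limn (series u).
  by apply: le_trans (ulim 0%N); rewrite /series /= big_nil.
(* The added 1 keeps the tolerance positive when [u] is zero; it also lets [m = 0] serve at
   [k = 0]. *)
have step k : exists m, [/\ limn (series u) - series u m <=
    (limn (series u) + 1) / 4 ^+ k, (k <= m)%N & k = 0%N -> m = 0%N].
  case: k => [|k].
    by exists 0%N; split=> //; rewrite /series /= big_nil expr0 divr1 subr0 lerDl.
  have e0 : 0 < (limn (series u) + 1) / 4 ^+ k.+1.
    by rewrite divr_gt0 ?exprn_gt0// ltr_wpDl.
  have [m _ mP] := cvgr_dist_lt _ _ cu _ e0.
  exists (maxn m k.+1); split=> //; last by rewrite leq_maxr.
  by apply: le_trans (ler_norm _) _; apply: ltW; apply: mP; rewrite /= leq_maxl.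
have [M MP] := choice step.
(* Cumulative sums are nondecreasing and stay beyond [M k], where the tail is already small. *)
pose N k := (\sum_(0 <= j < k.+1) M j)%N.
have NS k : N k.+1 = (N k + M k.+1)%N by rewrite /N big_nat_recr.
have MN k : (M k <= N k)%N by rewrite /N big_nat_recr//= leq_addl.
exists N, (limn (series u) + 1); first split.
- by rewrite /N big_nat1; have [_ _ ->] := MP 0%N.
- by move=> k; rewrite NS leq_addr.
- by move=> k; apply: leq_trans (MN k); have [] := MP k.
move=> k; have [h _ _] := MP k; apply: le_trans h.
have -> : \sum_(N k <= n < N k.+1) u n = series u (N k.+1) - series u (N k).
  by rewrite sub_series NS leq_addr.
by rewrite lerB//; exact: und.
Qed.

End Blocks.

Section TrigPolynomials.
Variables (R : realType) (G : topologicalZmodType).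
Variable mu : probability (borel G) R.
Variable e : nat -> G -> R[i].
Hypothesis chare : forall n, is_character (e n).
Hypothesis orthe : forall m n, fourier_coef mu (e m) (e n) = (m == n)%:R.
Variable c : nat -> R[i].

Definition trig_poly (r : seq nat) (x : G) : R[i] := \sum_(n <- r) c n * e n x.

Lemma trig_poly_measurable r : Cmeasurable (trig_poly r).
Proof.
apply: Cmeasurable_sum => n; apply: CmeasurableM.
  exact: Cmeasurable_cst.
exact: is_character_measurable.
Qed.

Lemma Cintegrable_trig_poly_conj r h : is_character h ->
  Cintegrable mu (fun x => trig_poly r x * (h x)^*).
Proof.
move=> hc; under eq_fun do rewrite /trig_poly mulr_suml.
apply: Cintegrable_sum => n; under eq_fun do rewrite -mulrA.
by apply: CintegrableZ; apply: Cintegrable_character; exact: is_character_mul_conj.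
Qed.

Lemma fourier_coef_trig_poly r h : is_character h ->
  fourier_coef mu (trig_poly r) h = \sum_(n <- r) c n * fourier_coef mu (e n) h.
Proof.
move=> hc; rewrite /fourier_coef.
have ic n : Cintegrable mu (fun x => e n x * (h x)^*).
  by apply: Cintegrable_character; exact: is_character_mul_conj.
under eq_fun do rewrite /trig_poly mulr_suml.
rewrite Cintegral_sum => [|n]; last first.
  by under eq_fun do rewrite -mulrA; exact: CintegrableZ.
apply: eq_bigr => n _.
by under eq_fun do rewrite -mulrA; exact: CintegralZ.
Qed.

(** Expanding only the conjugate factor of [P * P^*] leaves integrals of [P * (e m)^*], which are
    Fourier coefficients of [P]. Without repetitions in [r], orthonormality makes them equal to
    [c m]. *)
Lemma integral_sqr_trig_poly r : uniq r ->
  (\int[mu]_x (normc (trig_poly r x) ^+ 2)%:E =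
   (\sum_(n <- r) normc (c n) ^+ 2)%:E)%E.
Proof.
move=> ur; set P := trig_poly r.
have PP x : (normc (P x) ^+ 2)%:C = \sum_(m <- r) (c m)^* * (P x * (e m x)^*).
  rewrite -mulcJE {2}/P /trig_poly rmorph_sum mulr_sumr.
  by apply: eq_bigr => m _; rewrite rmorphM mulrCA.
have iP m : Cintegrable mu (fun x => (c m)^* * (P x * (e m x)^*)).
  by apply: CintegrableZ; exact: Cintegrable_trig_poly_conj.
have [iPP _] : Cintegrable mu (fun x => (normc (P x) ^+ 2)%:C).
  by under eq_fun do rewrite PP; exact: Cintegrable_sum.
have : Cintegral mu (fun x => (normc (P x) ^+ 2)%:C) =
    (\sum_(n <- r) normc (c n) ^+ 2)%:C.
  under eq_fun do rewrite PP.
  rewrite Cintegral_sum// rmorph_sum [LHS]big_seq [RHS]big_seq.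
  apply: eq_bigr => m mr; rewrite CintegralZ; last first.
    exact: Cintegrable_trig_poly_conj.
  rewrite -/(fourier_coef mu P (e m)) fourier_coef_trig_poly//.
  rewrite (bigD1_seq m)//= orthe eqxx mulr1 big1 => [|n nm].
    by rewrite addr0 mulrC mulcJE.
  by rewrite orthe (negbTE nm) mulr0.
move=> /(congr1 (@complex.Re R)) /=; rewrite /Rintegral /= => <-.
by rewrite fineK//; exact: (integrable_fin_num measurableT iPP).
Qed.

End TrigPolynomials.

Section Domination.
Variables (R : realType) (G : topologicalZmodType).
Variable mu : probability (borel G) R.

(** The majorant takes extended values because it will come from a square function that is finite
    only almost everywhere. *)
Lemma Rintegral_dominated_cvg (u_ : nat -> borel G -> R) (u : borel G -> R)
    (g : borel G -> \bar R) :
  (forall K, measurable_fun setT (u_ K)) -> measurable_fun setT u ->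
  {ae mu, forall x, u_ ^~ x @ \oo --> u x} ->
  mu.-integrable setT g -> (forall K x, (`|u_ K x|%:E <= g x)%E) ->
  (fun K => Rintegral mu setT (u_ K)) @ \oo --> Rintegral mu setT u.
Proof.
move=> mu_ mu' cu ig ug.
have [|||||iu _] := @dominated_convergence _ (borel G) R mu setT measurableT
  (fun K x => (u_ K x)%:E) (fun x => (u x)%:E) g.
- by move=> K; exact/measurable_EFinP.
- exact/measurable_EFinP.
- by apply: filterS cu => x cx _; apply: cvg_EFin => //; exact: nearW.
- by [].
- by apply: aeW => x K _; rewrite abse_EFin.
- move=> cv; apply: fine_cvg; rewrite fineK//.
  exact: integrable_fin_num.
Qed.

Lemma Cintegral_dominated_cvg (T_ : nat -> G -> R[i]) (T : G -> R[i])
    (g : borel G -> \bar R) :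
  (forall K, Cmeasurable (T_ K)) -> Cmeasurable T ->
  {ae mu, forall x : borel G,
    (fun K => complex.Re (T_ K x)) @ \oo --> complex.Re (T x) /\
    (fun K => complex.Im (T_ K x)) @ \oo --> complex.Im (T x)} ->
  mu.-integrable setT g -> (forall K x, ((normc (T_ K x))%:E <= g x)%E) ->
  (fun K => complex.Re (Cintegral mu (T_ K))) @ \oo -->
    complex.Re (Cintegral mu T) /\
  (fun K => complex.Im (Cintegral mu (T_ K))) @ \oo -->
    complex.Im (Cintegral mu T).
Proof.
move=> mT_ [mRe mIm] cT ig Tg; split.
- apply: (Rintegral_dominated_cvg (g := g)) => //.
  + by move=> K; have [] := mT_ K.
  + by apply: filterS cT => x [].
  + by move=> K x; apply: le_trans (Tg K x); rewrite lee_fin ler_Re_normc.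
- apply: (Rintegral_dominated_cvg (g := g)) => //.
  + by move=> K; have [] := mT_ K.
  + by apply: filterS cT => x [].
  + by move=> K x; apply: le_trans (Tg K x); rewrite lee_fin ler_Im_normc.
Qed.

End Domination.

Section RieszFischer.
Variables (R : realType) (G : topologicalZmodType).
Variable mu : probability (borel G) R.
Variable e : nat -> G -> R[i].
Hypothesis chare : forall n, is_character (e n).
Hypothesis orthe : forall m n, fourier_coef mu (e m) (e n) = (m == n)%:R.
Variable c : nat -> R[i].
Hypothesis c2 : cvgn (series (fun n => normc (c n) ^+ 2)).

(* The N k-th partial sums are Cauchy in L_2 at a geometric rate, so the weighted
   square function W of their differences is integrable. It is finite almost
   everywhere and dominates the squares of the partial sums, which gives both
   the pointwise limit f and the convergence of its Fourier coefficients.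
   The pointwise limit is cut off by the indicator of [W < +oo] so that it
   exists everywhere. *)
Lemma riesz_fischer : exists2 f : G -> R[i], in_Lp mu 2%:E f &
  forall h (l : R[i]), is_character h ->
    (\forall K \near \oo, \sum_(0 <= n < K) c n * fourier_coef mu (e n) h = l) ->
    fourier_coef mu f h = l.
Proof.
have [N [C [N0 Nmono Nge] Nblock]] :=
  summable_geometric_blocks (fun n => sqr_ge0 (normc (c n))) c2.
pose b k : G -> R[i] := trig_poly e c (index_iota (N k) (N k.+1)).
have mb k : Cmeasurable (b k) by exact: trig_poly_measurable.
pose S K : G -> R[i] := trig_poly e c (index_iota 0 (N K)).
have mS K : Cmeasurable (S K) by exact: trig_poly_measurable.
have SE K x : S K x = \sum_(k < K) b k x.
  elim: K => [|K IH]; first by rewrite big_ord0 /S /trig_poly N0 big_geq.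
  by rewrite big_ord_recr -IH /S /b /trig_poly -big_cat_nat.
pose w k x := 2 ^+ k.+1 * normc (b k x) ^+ 2.
have w0 k x : 0 <= w k x by rewrite mulr_ge0 ?exprn_ge0 ?normc_ge0.
pose W (x : borel G) := (\sum_(k <oo) (w k x)%:E)%E.
have mw k : measurable_fun setT (fun x : borel G => (w k x)%:E).
  apply/measurable_EFinP; apply: measurable_funM; first exact: measurable_cst.
  by apply: measurable_funX; exact: measurable_normc.
have W0 x : (0 <= W x)%E by apply: nneseries_ge0 => k _ _; rewrite lee_fin.
have mW : measurable_fun setT W.
  apply: (@emeasurable_fun_cvg _ (borel G) R setT
    (fun K x => \sum_(0 <= k < K) (w k x)%:E)%E) => [K|x _].
    by apply: emeasurable_sum => k; exact: mw.
  by apply: is_cvg_nneseries => k _ _; rewrite lee_fin.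
have iW : mu.-integrable setT W.
  apply/integrableP; split=> //.
  under eq_integral do rewrite gee0_abs//.
  rewrite integral_nneseries//; last by move=> k x _; rewrite lee_fin.
  (* By Parseval the integral of [w k] is [2 ^+ k.+1] times a block sum, hence at most [2 ^+ k.+1 *
     C / 4 ^+ k = 4 * C / 2 ^+ (k + 1)]; the total is [4 * C]. *)
  apply: (@le_lt_trans _ _ (\sum_(k <oo) (4 * C / (2 ^ (k + 1))%:R)%:E)%E).
    apply: lee_nneseries => [k _ _|k _].
      by apply: integral_ge0 => x _; rewrite lee_fin.
    under eq_integral do rewrite EFinM.
    rewrite ge0_integralZl//; last 2 first.
    - apply/measurable_EFinP; apply: measurable_funX; exact: measurable_normc.
    - by move=> x _; rewrite lee_fin sqr_ge0.
    rewrite integral_sqr_trig_poly ?iota_uniq// -EFinM lee_fin.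
    apply: le_trans (ler_wpM2l _ (Nblock k)) _; first by rewrite exprn_ge0.
    have -> : (4 : R) ^+ k = 2 ^+ k * 2 ^+ k by rewrite -exprMn -natrM.
    rewrite addn1 natrX !exprS.
    have p0 : (2 : R) ^+ k != 0 by rewrite expf_neq0.
    by rewrite le_eqVlt; apply/orP; left; apply/eqP; field.
  by rewrite (cvg_lim _ (@cvg_geometric_eseries_half R (4 * C) 0))// ltry.
have SW K x : ((normc (S K x) ^+ 2)%:E <= W x)%E.
  apply: (@le_trans _ _ (\sum_(0 <= k < K) (w k x)%:E)%E); last first.
    by apply: nneseries_lim_ge => k _ _; rewrite lee_fin.
  rewrite sumEFin lee_fin big_mkord.
  apply: le_trans (sqr_sum_le (fun k => normc (b k x)) K).
  rewrite ler_pXn2r ?nnegrE ?normc_ge0//; last first.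
    by apply: sumr_ge0 => k _; exact: normc_ge0.
  rewrite SE; elim/big_rec2: _ => [|k r z _ zr]; first by rewrite normc0.
  by apply: le_trans (le_normcD _ _) _; rewrite lerD2l.
pose A := [set x : borel G | (W x < +oo)%E].
have mA : measurable A.
  by rewrite -[A]setTI; exact: (emeasurable_fun_infty_o measurableT mW).
have Wfin x : A x -> W x \is a fin_num by move=> Ax; rewrite ge0_fin_numE.
have cb x : A x -> cvgn (series (fun k => normc (b k x))).
  move=> Ax; apply: nondecreasing_is_cvgn.
    by apply: nondecreasing_series => k _ _; exact: normc_ge0.
  (* The bound [t <= 1 + t ^+ 2] passes from the square to the sum itself. *)
  exists (1 + fine (W x)) => _ [K _ <-].
  suff : series (fun k => normc (b k x)) K ^+ 2 <= fine (W x).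
    set t := series _ _; have := sqr_ge0 (t - 1); rewrite sqrrB expr1n mulr1.
    by have := sqr_ge0 t; lra.
  rewrite -lee_fin fineK ?Wfin// /series /= big_mkord.
  apply: (@le_trans _ _ (\sum_(0 <= k < K) (w k x)%:E)%E); last first.
    by apply: nneseries_lim_ge => k _ _; rewrite lee_fin.
  by rewrite sumEFin lee_fin big_mkord; exact: (sqr_sum_le (fun k => normc (b k x))).
pose reb x k := complex.Re (b k x) * \1_A x.
pose imb x k := complex.Im (b k x) * \1_A x.
have cvb x : cvgn (series (reb x)) /\ cvgn (series (imb x)).
  have [xA|xA] := boolP (x \in A).
    have -> : reb x = (fun k => complex.Re (b k x)).
      by apply/funext => k; rewrite /reb indicE xA mulr1.
    have -> : imb x = (fun k => complex.Im (b k x)).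
      by apply/funext => k; rewrite /imb indicE xA mulr1.
    by apply: normc_cvg_series_ReIm; apply: cb; rewrite -inE.
  have -> : reb x = (fun=> 0).
    by apply/funext => k; rewrite /reb indicE (negbTE xA) mulr0.
  have -> : imb x = (fun=> 0).
    by apply/funext => k; rewrite /imb indicE (negbTE xA) mulr0.
  have c0 : cvgn (series (fun=> 0 : R)).
    apply: (cvgP (0 : R)); apply: cvg_near_cst; apply: nearW => n.
    by rewrite /series /= big1.
  by [].
pose f (x : G) := limn (series (reb x)) +i* limn (series (imb x)).
have mf : Cmeasurable f.
  split.
  - apply: (@measurable_fun_cvg _ (borel G) R setT (fun K x => series (reb x) K)) => [K|x _].
      apply: measurable_sum => k; apply: measurable_funM; first by have [] := mb k.
      exact: measurable_indic.
    exact: (cvb x).1.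
  - apply: (@measurable_fun_cvg _ (borel G) R setT (fun K x => series (imb x) K)) => [K|x _].
      apply: measurable_sum => k; apply: measurable_funM; first by have [] := mb k.
      exact: measurable_indic.
    exact: (cvb x).2.
have Sf (x : borel G) : A x ->
    (fun K => complex.Re (S K x)) @ \oo --> complex.Re (f x) /\
    (fun K => complex.Im (S K x)) @ \oo --> complex.Im (f x).
  move=> Ax; have [cRe cIm] := cvb x; split.
  - rewrite (_ : (fun K => _) = series (reb x))//; apply/funext => K.
    rewrite SE Re_sum /series /= big_mkord; apply: eq_bigr => k _.
    by rewrite /reb indicE mem_set// mulr1.
  - rewrite (_ : (fun K => _) = series (imb x))//; apply/funext => K.
    rewrite SE Im_sum /series /= big_mkord; apply: eq_bigr => k _.
    by rewrite /imb indicE mem_set// mulr1.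
have fW x : ((normc (f x) ^+ 2)%:E <= W x)%E.
  have [Ax|nAx] := pselect (A x); last first.
    by move/negP: nAx; rewrite -leNgt leye_eq => /eqP ->; exact: leey.
  have [cRe cIm] := Sf x Ax.
  rewrite -(fineK (Wfin x Ax)) lee_fin sqr_normcE.
  have cS : (fun K => complex.Re (S K x) ^+ 2 + complex.Im (S K x) ^+ 2) @ \oo
      --> complex.Re (f x) ^+ 2 + complex.Im (f x) ^+ 2.
    by apply: cvgD; rewrite expr2; under eq_fun do rewrite expr2; exact: cvgM.
  rewrite -(cvg_lim _ cS)//; apply: limr_le; first exact: (cvgP _ cS).
  by apply: nearW => K; rewrite -sqr_normcE -lee_fin fineK ?Wfin.
exists f.
  case: mf => mRe mIm; split=> //.
  rewrite unlock; apply: poweR_lty.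
  have sqrE x : (`|(normc (f x))%:E| `^ 2 = (normc (f x) ^+ 2)%:E)%E.
    rewrite abse_EFin poweR_EFin powR_mulrn ?normr_ge0//.
    by rewrite real_normK ?num_real.
  under eq_integral do rewrite sqrE.
  apply: (@le_lt_trans _ _ (\int[mu]_x W x)%E); last exact: integrable_lty.
  apply: ge0_le_integral => //.
  - by move=> x _; rewrite lee_fin sqr_ge0.
  - by apply/measurable_EFinP; apply: measurable_funX; exact: measurable_normc.
move=> h l hc near_l.
have mh := is_character_measurable hc.
have nh x : normc (h x)^* = 1 by case: hc => _ nh _; rewrite normc_conj nh.
(* [W] dominates the squares of the partial sums. By [t <= 1 + t ^+ 2] the function [1 + W]
   dominates the sums themselves, and it is integrable because [mu] is finite. *)
have [|||||cRe cIm] := @Cintegral_dominated_cvg _ _ mu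
  (fun K x => S K x * (h x)^*) (fun x => f x * (h x)^*)
  (fun x => 1%:E + W x)%E.
- by move=> K; apply: CmeasurableM => //; exact: Cmeasurable_conj.
- by apply: CmeasurableM => //; exact: Cmeasurable_conj.
- apply: filterS (integrable_ae measurableT iW) => x /(_ I) Wx.
  have [cRe cIm] := Sf x (ltac:(by rewrite /A /= -ge0_fin_numE)).
  have mulE (z y : R[i]) : z * y =
      (complex.Re z * complex.Re y - complex.Im z * complex.Im y) +i*
      (complex.Re z * complex.Im y + complex.Im z * complex.Re y).
    by case: z y => [? ?] [? ?].
  under eq_fun do rewrite mulE; under [in X in _ /\ X]eq_fun do rewrite mulE.
  rewrite mulE /=; split.
  + by apply: cvgB; apply: cvgMl.
  + by apply: cvgD; apply: cvgMl.
- by apply: integrableD => //; exact: (finite_measure_integrable_cst mu 1).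
- move=> K x; rewrite normcM nh mulr1.
  apply: (@le_trans _ _ (1 + (normc (S K x) ^+ 2)%:E)%E); last exact: leeD2l.
  rewrite -EFinD lee_fin; set t := normc _.
  by have := sqr_ge0 (t - 1); have := sqr_ge0 t; rewrite sqrrB expr1n mulr1; lra.
(* As [K <= N K], the coefficients of [S K] at [h] are eventually equal to [l], so their limit is
   [l]. *)
have near_S : \forall K \near \oo,
    Cintegral mu (fun x => S K x * (h x)^*) = l.
  have [M _ MP] := near_l; exists M => // K /= MK.
  rewrite -/(fourier_coef mu (S K) h) fourier_coef_trig_poly//.
  by apply: MP => /=; apply: leq_trans MK _; exact: Nge.
rewrite -/(fourier_coef mu f h) in cRe cIm.
apply/eqP; rewrite eq_complex; apply/andP; split; apply/eqP.
- rewrite -(cvg_lim _ cRe)//; apply: lim_near_cst => //.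
  by apply: filterS near_S => K ->.
- rewrite -(cvg_lim _ cIm)//; apply: lim_near_cst => //.
  by apply: filterS near_S => K ->.
Qed.

End RieszFischer.

(** * Coefficients of Hardy spaces *)

Section HardyCoefficients.
Variables (R : realType) (lam : nat -> R) (G : topologicalZmodType).
Variables (mu : probability (borel G) R) (beta : R -> G).

(** The set where [h * h'^*] differs from 1 is open and misses the dense range of [beta], hence is
    empty. *)
Lemma extends_exp_uniq (l : R) (h h' : G -> R[i]) : dense (range beta) ->
  extends_exp beta l h -> extends_exp beta l h' -> h = h'.
Proof.
move=> dbeta [hc hE] [hc' hE']; apply/funext => x; apply: contrapT => hx.
have [ck _ _] := is_character_mul_conj hc hc'.
pose U := [set y | h y * (h' y)^* != 1].
have oU : open U.
  pose r y := complex.Re (h y * (h' y)^*).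
  have cr : continuous r.
    by move=> y; exact: (continuous_comp (ck y) (@Re_continuous R _)).
  pose s y := complex.Im (h y * (h' y)^*).
  have cs : continuous s.
    by move=> y; exact: (continuous_comp (ck y) (@Im_continuous R _)).
  have -> : U = (r @^-1` [set~ 1]) `|` (s @^-1` [set~ 0]).
    apply/seteqP; split => [y|y].
      rewrite /U /= eq_complex negb_and => /orP[] /eqP; by [left|right].
    rewrite /U /= eq_complex negb_and.
    by case=> /= /eqP yn; rewrite yn ?orbT.
  apply: openU; (apply: open_comp => [? _ //|];
    rewrite openC; exact: closed_eq).
have [|y [Uy [t _ tE]]] := dbeta U _ oU.
  exists x => /=; rewrite /U /=; apply/eqP => hx1; apply: hx.
  rewrite -[LHS]mulr1 -(mulc_conj_character hc' x) mulrCA hx1 mulr1.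
  by [].
by move: Uy; rewrite -tE /U /= hE -hE' mulc_conj_character// eqxx.
Qed.

Lemma extends_exp_inj (l l' : R) (h : G -> R[i]) :
  extends_exp beta l h -> extends_exp beta l' h -> l = l'.
Proof.
move=> [_ hE] [_ hE']; apply/eqP; rewrite -subr_eq0; apply: contrapT => /negP ll.
(* At this [t] the two exponentials are half a turn apart; equal values would make the cosine of
   [pi] equal to 1. *)
pose t := pi / (l - l').
have := hE t; rewrite hE' /Cexp !expR0 => -[].
rewrite !mul0r !subr0 !addr0 !mul1r !cosN !sinN => ecos /oppr_inj esin.
have : cos (l * t - l' * t) = -1.
  by rewrite -mulrBl /t mulrC divfK// cospi.
rewrite cosB ecos esin -!expr2 cos2Dsin2 => /eqP.
by rewrite -subr_eq0 opprK -mulr2n pnatr_eq0.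
Qed.

(** Strict monotonicity of [lam] makes the chosen characters distinct, hence orthonormal.
    [riesz_fischer] then serves twice: with limit 0 at a character outside the frequency, where all
    partial sums vanish, and with limit [a n] at the character of [lam n], reached as soon as
    [K > n]. *)
Lemma Hardy2_sqr_summable (a : nat -> R[i]) :
  is_frequency lam -> is_haar mu -> is_dirichlet_group lam beta ->
  cvgn (series (fun n => normc (a n) ^+ 2)) -> Hardy lam mu beta 2%:E a.
Proof.
move=> [_ lam_inc _] haar [_ _ [_ _ dbeta /choice[e eE]]] a2.
have ce n : is_character (e n) := (eE n).1.
have lam_inj m n : lam m = lam n -> m = n.
  move=> mn; apply/eqP; rewrite eqn_leq; apply/andP; split;
    by rewrite leqNgt; apply/negP => /lam_inc; rewrite mn ltxx.
have orth m n : fourier_coef mu (e m) (e n) = (m == n)%:R.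
  rewrite fourier_coef_character//; congr (nat_of_bool _)%:R.
  apply/eqP/eqP => [emn|->//]; apply: lam_inj.
  by apply: (@extends_exp_inj _ _ (e m)); [exact: eE|rewrite emn; exact: eE].
have [f f2 fE] := riesz_fischer ce orth a2.
exists f.
  split=> // h hc hlam; apply: fE => //; apply: nearW => K.
  rewrite big1// => n _; rewrite fourier_coef_character//.
  by case: eqP => [enh|_]; [case: (hlam n); rewrite -enh|rewrite mulr0].
move=> n h hE; rewrite (extends_exp_uniq dbeta hE (eE n)).
apply/esym/fE => //; exists n.+1 => // K /= nK.
rewrite (bigD1_seq n) ?mem_index_iota ?iota_uniq//= orth eqxx mulr1.
by rewrite big1 ?addr0// => m mn; rewrite orth (negbTE mn) mulr0.
Qed.

Lemma Hardy1_bounded (a : nat -> R[i]) :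
  is_dirichlet_group lam beta -> Hardy lam mu beta 1 a ->
  exists M : R, forall n, normc (a n) <= M.
Proof.
move=> [_ _ [_ _ _ hlam]] [f [[mRe mIm]]].
have mf : Cmeasurable f by [].
rewrite Lnorm1 => f1 _ aE.
have if1 : mu.-integrable setT (fun x : borel G => (normc (f x))%:E).
  apply/integrableP; split; last exact: f1.
  by apply/measurable_EFinP; exact: measurable_normc.
(* Characters are unimodular, so the real and imaginary parts of a coefficient are each bounded by
   the [L_1] norm of [f]; hence the doubling. *)
exists (Rintegral mu setT (fun x => normc (f x)) *+ 2) => n.
have [h hE] := hlam n; rewrite (aE _ _ hE).
have hc := hE.1.
have nfh x : normc (f x * (h x)^*) = normc (f x).
  by case: hc => _ nh _; rewrite normcM normc_conj nh mulr1.
have [iRe iIm] : Cintegrable mu (fun x => f x * (h x)^*).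
  apply: (Cintegrable_le _ if1) => [|x]; last by rewrite nfh.
  apply: CmeasurableM => //; apply: Cmeasurable_conj.
  exact: is_character_measurable.
apply: le_trans (normc_le_ReIm _) _; rewrite mulr2n; apply: lerD.
- apply: le_trans (le_normr_Rintegral measurableT iRe) _.
  apply: le_Rintegral => //; first exact: (integrable_norm iRe).
  by move=> x _; rewrite -nfh ler_Re_normc.
- apply: le_trans (le_normr_Rintegral measurableT iIm) _.
  apply: le_Rintegral => //; first exact: (integrable_norm iIm).
  by move=> x _; rewrite -nfh ler_Im_normc.
Qed.

End HardyCoefficients.

(** * Comparison of the two abscissas *)

Section Comparison.
Variables (R : realType) (lam : nat -> R) (G : topologicalZmodType).
Variables (mu : probability (borel G) R) (beta : R -> G).

Lemma normc_Cexp (z : R[i]) : normc (Cexp z) = expR (complex.Re z).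
Proof.
case: z => x y; rewrite /Cexp normcM normc_real ger0_norm ?expR_ge0//=.
by rewrite cos2Dsin2 sqrtr1 mulr1.
Qed.

Lemma Re_dirichlet_term (a l t : R) :
  complex.Re (a%:C * Cexp (- l%:C * t%:C)) = a * expR (- l * t).
Proof.
by rewrite /= !(mul0r, mulr0, oppr0, subr0, addr0) cos0 mulr1.
Qed.

(** Stated for one real [sigma] admissible in the infimum that defines the abscissa of [H_2], so
    that the infinite values of that abscissa need no case distinction. *)
Lemma le_sigma_H1 (sigma : R) :
  is_frequency lam -> is_haar mu -> is_dirichlet_group lam beta ->
  (forall a, Hardy lam mu beta 2%:E a -> (sigma_c lam a <= sigma%:E)%E) ->
  (sigma_H lam mu beta 1 <= (2 * sigma)%:E)%E.
Proof.
move=> freq haar dir H2; have [lam0 _ _] := freq.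
apply/lee_addgt0Pr => e e0; rewrite -EFinD.
(* The bound [sigma_c <= sigma] gives convergence only strictly to the right of [sigma]; the shift
   costs [e] after doubling. *)
pose tau := sigma + e / 2.
have -> : 2 * sigma + e = 2 * tau by rewrite /tau; field.
have sigma_tau : sigma < tau by rewrite ltrDl divr_gt0.
have sq : cvgn (series (fun n => expR (- lam n * tau) ^+ 2)).
  apply: contrapT => /(exists_sqr_summable_dvg (fun n => expR_gt0 _)).
  move=> [a a2]; apply.
  have Ha : Hardy lam mu beta 2%:E (fun n => (a n)%:C).
    apply: Hardy2_sqr_summable => //.
    by under eq_fun do rewrite normc_real real_normK ?num_real//.
  have : (sigma_c lam (fun n => (a n)%:C) < tau%:E)%E.
    by apply: le_lt_trans (H2 _ Ha) _; rewrite lte_fin.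
  move=> /ereal_inf_lt[_ [s cvs <-]]; rewrite lte_fin => stau.
  (* At the real point [tau] the real part of the Dirichlet series is exactly the divergent series
     of Abel-Dini. *)
  have /is_cvg_series_Re := cvs tau%:C stau.
  by under [X in series X]eq_fun do rewrite Re_dirichlet_term.
apply: ereal_inf_lbound; exists (2 * tau) => // a Ha.
have [M aM] := Hardy1_bounded dir Ha.
apply: ereal_inf_lbound; exists (2 * tau) => // s; rewrite /half_plane /= => ss.
apply: normc_cvg_series.
apply: (@series_le_cvg _ _ (M *: (fun n => expR (- lam n * tau) ^+ 2))) => [n|n|n|].
- exact: normc_ge0.
- by rewrite mulr_ge0 ?sqr_ge0// (le_trans (normc_ge0 (a n))).
- rewrite normcM normc_Cexp /=.
  apply: ler_pM => //; first exact: normc_ge0.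
  rewrite -expRM_natl ler_expR.
  case: s ss => x y /= ss.
  (* What remains is [lam n * (2 * tau) <= lam n * x], which holds for either sign of [tau] because
     [lam n] is nonnegative. *)
  rewrite oppr0 mul0r subr0 mulrCA !mulNr lerN2.
  by apply: ler_wpM2l => //; exact: ltW.
- exact: is_cvg_seriesZ.
Qed.

End Comparison.

Theorem proposition5p1 (R : realType) (lam : nat -> R)
    (G : topologicalZmodType) (mu : probability (borel G) R) (beta : R -> G) :
  is_frequency lam -> is_haar mu -> is_dirichlet_group lam beta ->
  (sigma_H lam mu beta 1 <= 2%:E * sigma_H lam mu beta 2%:E)%E.
Proof.
(* With the factor on the left, half the abscissa of [H_1] has to be a lower bound of the admissible
   [sigma]. If there are none, the infimum is [+oo] and nothing is left to prove. *)
move=> freq haar dir; rewrite -lee_pdivrMl//.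
apply: le_ereal_inf_tmp => _ [sigma H2 <-].
by rewrite lee_pdivrMl// -EFinM; exact: le_sigma_H1.
Qed.
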